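(* Let $b$ be a positive integer and $t$ an integer with $0\le t\le b$ and $2t>b$. Let $M=(m_n)_{n\ge0}$ be the lexicographically smallest nonperiodic sequence in $\Gamma(\{b-t,\ldots,t\})$ (equivalently, the smallest element of $\Gamma_{strict}(\{b-t,\ldots,t\})$; this smallest element exists). Then $$\forall n\ge0,\quad m_n=\varepsilon_{n+1}-(2t-b-1)\varepsilon_n+t-1,$$ where $(\varepsilon_n)_{n\ge0}$ is the Thue–Morse sequence. Consequently: (i) if $2t\ge b+3$, then $M$ is the fixed point beginning with $t$ of the morphism obtained from $\Theta$ by renaming $e_0,e_1,e_2,e_3$ as $b-t,\ b-t+1,\ t-1,\ t$ respectively (these four integers are then distinct), i.e. the morphism $t\mapsto t\,(b-t+1)$, $(t-1)\mapsto t\,(b-t)$, $(b-t+1)\mapsto (b-t)\,t$, $(b-t)\mapsto (b-t)\,(t-1)$; (ii) if $2t=b+2$, then $M$ is the letterwise image of the fixed point $\Theta^\infty(e_3)$ under the map $g$ with $g(e_3)=t$, $g(e_2)=g(e_1)=t-1$, $g(e_0)=b-t$; (iii) if $2t=b+1$, then $M$ is the letterwise image of $\Theta^\infty(e_3)$ under the map $h$ with $h(e_3)=h(e_1)=t$, $h(e_2)=h(e_0)=t-1$.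
   Context: $\{b-t,\ldots,t\}$ carries the natural order of the integers and the bar operation $\overline{x}=b-x$, extended letterwise to sequences. $\sigma$ is the shift $\sigma((a_n)_{n\ge0})=(a_{n+1})_{n\ge0}$ and $\le$ the lexicographical order on sequences ($A<B$ means $A\le B$, $A\neq B$). $\Gamma(\mathcal A)$ is the set of $A=(a_n)\in\mathcal A^{\mathbb N}$ with $a_0=\max\mathcal A$ and $\overline{A}\le\sigma^kA\le A$ for all $k\ge0$; $\Gamma_{strict}(\mathcal A)$ is the set of $A\in\mathcal A^{\mathbb N}$ with $a_0=\max\mathcal A$ and $\overline{A}<\sigma^kA<A$ for all $k\ge1$. A sequence is periodic if $\sigma^kA=A$ for some $k\ge1$. The Thue–Morse sequence is defined by $\varepsilon_0=0$, $\varepsilon_{2k}=\varepsilon_k$, $\varepsilon_{2k+1}=1-\varepsilon_k$. The morphism $\Theta$ on the alphabet $\{e_0,e_1,e_2,e_3\}$ is $\Theta(e_3)=e_3e_1$, $\Theta(e_2)=e_3e_0$, $\Theta(e_1)=e_0e_3$, $\Theta(e_0)=e_0e_2$, and $\Theta^\infty(e_3)=\lim_{k\to\infty}\Theta^k(e_3)$ is its infinite fixed point beginning with $e_3$. *)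

(* Defs.v *)
From HB Require Import structures.
From mathcomp Require Import all_boot all_order all_algebra.
From mathcomp Require Import zify.
Set Implicit Arguments.
Unset Strict Implicit.
Unset Printing Implicit Defensive.
Import Order.TTheory GRing.Theory Num.Theory.
Local Open Scope ring_scope.

Definition shift (T : Type) (A : nat -> T) : nat -> T := fun n => A n.+1.

Definition periodic (T : Type) (A : nat -> T) : Prop :=
  exists k : nat, (1 <= k)%N /\ iter k (@shift T) A =1 A.

Definition lex_le (A B : nat -> int) : Prop :=
  A =1 B \/
  exists n : nat, (forall i : nat, (i < n)%N -> A i = B i) /\ A n < B n.

Definition lex_lt (A B : nat -> int) : Prop := lex_le A B /\ ~ (A =1 B).

Definition is_smallest (P : (nat -> int) -> Prop) (M : nat -> int) : Prop :=
  P M /\ forall A : nat -> int, P A -> lex_le M A.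

Definition alphabet (b t : int) : pred int := [pred x | b - t <= x <= t].

Definition is_max (L : pred int) (x : int) : Prop :=
  L x /\ forall y : int, L y -> y <= x.

Definition bar (b : int) (A : nat -> int) : nat -> int := fun n => b - A n.

Definition Gamma (b t : int) (A : nat -> int) : Prop :=
  [/\ forall n : nat, alphabet b t (A n),
      is_max (alphabet b t) (A 0%N)
    & forall k : nat, lex_le (bar b A) (iter k (@shift int) A) /\
                      lex_le (iter k (@shift int) A) A].

Definition Gamma_strict (b t : int) (A : nat -> int) : Prop :=
  [/\ forall n : nat, alphabet b t (A n),
      is_max (alphabet b t) (A 0%N)
    & forall k : nat, (1 <= k)%N ->
                      lex_lt (bar b A) (iter k (@shift int) A) /\
                      lex_lt (iter k (@shift int) A) A].

(* [fuel] bounds the recursion depth; [thue_morse0], [thue_morse_double] and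
   [thue_morse_doubleS] below are the defining recurrence. *)
Fixpoint thue_morse_rec (fuel n : nat) : int :=
  if fuel is fuel'.+1 then
    if n == 0%N then 0
    else if odd n then 1 - thue_morse_rec fuel' n./2
    else thue_morse_rec fuel' n./2
  else 0.

Definition thue_morse (n : nat) : int := thue_morse_rec n n.

Lemma thue_morse_rec_fuel (p q n : nat) :
  (n <= p)%N -> (n <= q)%N -> thue_morse_rec p n = thue_morse_rec q n.
Proof.
elim: p q n => [|p IH] [|q] [|n] //= hp hq.
have h : (uphalf n <= n)%N by lia.
by rewrite (IH q) //; lia.
Qed.

Lemma thue_morse0 : thue_morse 0 = 0.
Proof. by []. Qed.

Lemma thue_morse_half (n : nat) : (0 < n)%N ->
  thue_morse n = if odd n then 1 - thue_morse n./2 else thue_morse n./2.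
Proof.
case: n => [|n] // _; rewrite /thue_morse [LHS]/= -/(n.+1./2) -/(odd n.+1).
by rewrite (@thue_morse_rec_fuel n n.+1./2) //; lia.
Qed.

Lemma thue_morse_double (k : nat) : thue_morse (2 * k)%N = thue_morse k.
Proof.
case: k => [|k] //; rewrite thue_morse_half ?muln_gt0 // mul2n.
by rewrite odd_double doubleK.
Qed.

Lemma thue_morse_doubleS (k : nat) :
  thue_morse (2 * k + 1)%N = 1 - thue_morse k.
Proof.
rewrite thue_morse_half ?addn1 // mul2n /= odd_double /=.
by rewrite uphalf_double.
Qed.

(* A morphism of free monoids, given by the images of the letters. *)
Definition morph (T : Type) (f : T -> seq T) (w : seq T) : seq T :=
  flatten (map f w).

(* Convergence of finite words to an infinite word; in particular the lengths
   of the words tend to infinity. *)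
Definition words_cvg (T : Type) (u : nat -> seq T) (A : nat -> T) : Prop :=
  forall n : nat, exists K : nat, forall k : nat, (K <= k)%N ->
    onth (u k) n = Some (A n).

(* The morphism is extended to infinite words by continuity: the image of [A]
   is the limit of the images of its prefixes. *)
Definition fixed_word (T : Type) (f : T -> seq T) (A : nat -> T) : Prop :=
  words_cvg (fun k => morph f (mkseq A k)) A.

Definition the_fixed_word_from (T : Type) (f : T -> seq T) (a : T)
    (A : nat -> T) : Prop :=
  [/\ A 0%N = a, fixed_word f A
    & forall B : nat -> T, B 0%N = a -> fixed_word f B -> B =1 A].

Variant letter : Set := e0 | e1 | e2 | e3.

Definition Theta (e : letter) : seq letter :=
  match e with
  | e3 => [:: e3; e1]
  | e2 => [:: e3; e0]
  | e1 => [:: e0; e3]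
  | e0 => [:: e0; e2]
  end.

(* Since Theta^n(e3) has length 2^n > n and is a prefix of Theta^k(e3) for all
   k >= n, this is the limit of the words Theta^k(e3): see [Theta_inf_cvg]. *)
Definition Theta_inf (n : nat) : letter :=
  nth e3 (iter n (morph Theta) [:: e3]) n.

Lemma morph_cat (T : Type) (f : T -> seq T) (v w : seq T) :
  morph f (v ++ w) = morph f v ++ morph f w.
Proof. by rewrite /morph map_cat flatten_cat. Qed.

Lemma size_morph_Theta (w : seq letter) :
  size (morph Theta w) = (2 * size w)%N.
Proof.
elim: w => [|e w IH] //=.
by rewrite -cat1s morph_cat size_cat IH; case: e => /=; lia.
Qed.

Lemma size_iter_Theta (n : nat) :
  size (iter n (morph Theta) [:: e3]) = (2 ^ n)%N.
Proof. by elim: n => [|n IH] //=; rewrite size_morph_Theta IH expnS. Qed.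

Lemma iter_Theta_prefix (n k : nat) : (n <= k)%N ->
  exists w, iter k (morph Theta) [:: e3] = iter n (morph Theta) [:: e3] ++ w.
Proof.
have step m : exists w,
    iter m.+1 (morph Theta) [:: e3] = iter m (morph Theta) [:: e3] ++ w.
  elim: m => [|m [w IH]]; first by exists [:: e1].
  by exists (morph Theta w); rewrite [LHS]iterS {1}IH morph_cat.
move=> /subnK <-; elim: (k - n)%N => [|d [w IH]].
  by exists [::]; rewrite cats0.
have [v Hv] := step (d + n)%N.
by exists (w ++ v); rewrite addSn Hv IH catA.
Qed.

Lemma Theta_inf_nth (n k : nat) : (n < 2 ^ k)%N ->
  onth (iter k (morph Theta) [:: e3]) n = Some (Theta_inf n).
Proof.
move=> nk; rewrite onthE (nth_map e3) ?size_iter_Theta //; congr Some.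
have hn : (n < 2 ^ n)%N by apply: ltn_expl.
rewrite /Theta_inf; have [h|h] := leqP n k.
  by have [w ->] := iter_Theta_prefix h; rewrite nth_cat size_iter_Theta hn.
have [w ->] := iter_Theta_prefix (ltnW h).
by rewrite nth_cat size_iter_Theta nk.
Qed.

Lemma Theta_inf_cvg :
  words_cvg (fun k => iter k (morph Theta) [:: e3]) Theta_inf.
Proof.
move=> n; exists n => k nk; apply: Theta_inf_nth.
by apply: leq_trans (ltn_expl n (isT : 1 < 2)%N) _; rewrite leq_exp2l.
Qed.

Definition rename4 (b t : int) (e : letter) : int :=
  match e with
  | e0 => b - t
  | e1 => b - t + 1
  | e2 => t - 1
  | e3 => t
  end.

(* A morphism on the four letters b-t, b-t+1, t-1, t; the value on any other
   integer is irrelevant. *)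
Definition Theta_bt (b t : int) (x : int) : seq int :=
  if x == t then [:: t; b - t + 1]
  else if x == t - 1 then [:: t; b - t]
  else if x == b - t + 1 then [:: b - t; t]
  else if x == b - t then [:: b - t; t - 1]
  else [:: x].

Definition g_map (b t : int) (e : letter) : int :=
  match e with
  | e3 => t
  | e2 | e1 => t - 1
  | e0 => b - t
  end.

Definition h_map (t : int) (e : letter) : int :=
  match e with
  | e3 | e1 => t
  | e2 | e0 => t - 1
  end.

(* Main.v *)
Require Import Defs.
From HB Require Import structures.
From mathcomp Require Import all_boot all_order all_algebra.
From mathcomp Require Import zify.
From Stdlib Require Import Classical.
Import Order.TTheory GRing.Theory Num.Theory.
Local Open Scope ring_scope.

(** Write [N n = eps_(n+1) - (2t-b-1) eps_n + t - 1].  The complement of the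
    bits of the Thue-Morse sequence is the bar operation on [N], so the
    prefixes [W_k] of [N] of length [2^k] satisfy
    [W_(k+1) = W_k (bar W_k)^+], where [+] increments the last letter.

    [N] is strictly admissible because a first discrepancy between the shifted
    Thue-Morse sequence and each of its shifts (or complemented shifts) can be
    located recursively through [eps_2k = eps_k], [eps_(2k+1) = 1 - eps_k].

    [N] is minimal: if an admissible [A] is smaller than [N], with first
    difference in the block [2^k <= n < 2^(k+1)], then either
    [sigma^(2^k) A < bar A], or [A] begins with [W_k (bar W_k)]; in the latter
    case the two admissibility inequalities propagate
    [sigma^(2^k) A = bar A] to all positions, which strictness forbids. *)

Lemma iter_shiftE (T : Type) (k n : nat) (A : nat -> T) :
  iter k (@shift T) A n = A (k + n)%N.
Proof. by elim: k n => [|k IH] n //=; rewrite /shift IH addnS. Qed.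

(** * Lexicographic order *)

Lemma lex_le_first (A B : nat -> int) (n : nat) :
  lex_le A B -> (forall i, (i < n)%N -> A i = B i) -> A n <= B n.
Proof.
case=> [-> //|[m [eqm ltm]] eqn].
have [nm|mn|->] := ltngtP n m; [by rewrite eqm| |exact: ltW].
by rewrite eqn ?ltxx in ltm.
Qed.

Lemma lex_ltI (A B : nat -> int) (n : nat) :
  (forall i, (i < n)%N -> A i = B i) -> A n < B n -> lex_lt A B.
Proof.
move=> eqn ltn; split; first by right; exists n.
by move=> eAB; rewrite eAB ltxx in ltn.
Qed.

Lemma lex_le_total (A B : nat -> int) :
  lex_le A B \/
  exists n, (forall i, (i < n)%N -> A i = B i) /\ B n < A n.
Proof.
case: (classic (exists n, A n != B n)) => [exn|nex]; last first.
  by left; left => n; case: (A n =P B n) => // /eqP h; case: nex; exists n.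
case: (ex_minnP exn) => n neq minn.
have eqn i : (i < n)%N -> A i = B i.
  by move=> lt_in; apply/eqP; apply: contraTT lt_in => /minn; rewrite -leqNgt.
have [lt|gt|eq] := ltgtP (A n) (B n); last by rewrite eq eqxx in neq.
  by left; right; exists n.
by right; exists n.
Qed.

Lemma lex_le_anti (A B : nat -> int) : lex_le A B -> lex_le B A -> A =1 B.
Proof.
move=> AB BA n; elim/ltn_ind: n => n IH; apply/eqP; rewrite eq_le.
by rewrite !lex_le_first // => i /IH.
Qed.

Lemma is_smallest_uniq (P : (nat -> int) -> Prop) (A B : nat -> int) :
  is_smallest P A -> is_smallest P B -> A =1 B.
Proof. by move=> [PA minA] [PB minB]; apply: lex_le_anti; auto. Qed.

Lemma is_smallest_iff (P Q : (nat -> int) -> Prop) (M : nat -> int) :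
  (forall A, P A <-> Q A) -> is_smallest P M <-> is_smallest Q M.
Proof.
move=> PQ; split=> -[HM minM].
  by split=> [|A /PQ /minM //]; apply/PQ.
by split=> [|A /PQ /minM //]; apply/PQ.
Qed.

Lemma alphabet_max (b t : int) : b < 2 * t -> is_max (alphabet b t) t.
Proof. by move=> hbt; rewrite /alphabet /=; split=> [|y /andP[]] //=; lia. Qed.

Lemma Gamma_head (b t x : int) : b < 2 * t -> is_max (alphabet b t) x -> x = t.
Proof.
move=> hbt [Lx maxx]; have [Lt maxt] := alphabet_max _ _ hbt.
by apply/eqP; rewrite eq_le maxt ?maxx.
Qed.

(* If [sigma^k A = bar A] then [sigma^(2k) A = A], so a nonperiodic admissible
   sequence satisfies both inequalities strictly. *)
Lemma Gamma_nonperiodicE (b t : int) (A : nat -> int) : b < 2 * t ->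
  Gamma b t A /\ ~ periodic A <-> Gamma_strict b t A.
Proof.
move=> hbt; split=> [[[LA maxA adm] nper]|[LA maxA adm]].
  split=> // k k_gt0; have [lo hi] := adm k; split; split=> // eqA.
    apply: nper; exists (k + k)%N; split=> [|n]; first by lia.
    have e1 := eqA n; have e2 := eqA (k + n)%N.
    by rewrite !iter_shiftE /bar -?addnA in e1 e2 *; lia.
  by apply: nper; exists k.
split=> [|[k [k_gt0 eqA]]]; last by have [_ [_ ]] := adm k k_gt0.
split=> // -[|k]; last by have [[lo _] [hi _]] := adm k.+1 isT.
(* The case [k = 0] remains: [bar A] lies below [A] already at the first letter, as [b - t < t]. *)
split; last by left.
right; exists 0%N; split=> //=; rewrite /bar.
by rewrite (Gamma_head _ _ _ hbt maxA); lia.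
Qed.

(** * The Thue-Morse sequence *)

Definition tm (n : nat) : bool := thue_morse n == 1.

Lemma thue_morseE (n : nat) : thue_morse n = (tm n)%:Z.
Proof.
suff: thue_morse n = 0 \/ thue_morse n = 1 by rewrite /tm => -[->|->].
elim/ltn_ind: n => -[|n] IH; first by left.
rewrite thue_morse_half //.
have [|->|->] := IH n.+1./2; first lia.
  by case: odd; [right|left].
by case: odd; [left|right].
Qed.

Lemma tm_double (n : nat) : tm n.*2 = tm n.
Proof. by rewrite /tm -mul2n thue_morse_double. Qed.

Lemma tm_doubleS (n : nat) : tm n.*2.+1 = ~~ tm n.
Proof.
by rewrite {1}/tm -addn1 -mul2n thue_morse_doubleS thue_morseE; case: (tm n).
Qed.

Lemma tm0 : tm 0 = false. Proof. by []. Qed.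

(** Adding [2 ^ k] puts one more binary digit 1 on top of [j]; the induction strips the lowest
    digit. *)
Lemma tm_expn2D (k j : nat) : (j < 2 ^ k)%N -> tm (2 ^ k + j) = ~~ tm j.
Proof.
elim: k j => [|k IH] j; first by case: j.
rewrite expnS mul2n -(odd_double_half j) => ltj.
have {}IH : tm (2 ^ k + j./2) = ~~ tm j./2 by apply: IH; case: odd ltj; lia.
case: odd; rewrite ?add0n ?add1n ?addnS -doubleD ?tm_doubleS ?tm_double IH //.
Qed.

Lemma tm_expn2 (k : nat) : tm (2 ^ k).
Proof. by rewrite -[(2 ^ k)%N]addn0 tm_expn2D ?expn_gt0. Qed.

(* [c = false] says that the shifted sequence [tm _.+1] dominates its k-th
   shift; [c = true] says that its complement is dominated by that shift. *)
Lemma tm_first_diff (c : bool) (k : nat) : (0 < k)%N ->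
  exists n, [/\ forall i, (i < n)%N -> tm (k + i.+1) = c (+) tm i.+1,
                tm n.+1 & tm (k + n.+1) = c].
Proof.
elim/ltn_ind: k => k IH k_gt0; have := odd_double_half k.
case: (odd k) => /= defk; rewrite -defk.
  (* Odd [k]: the bits at [k + 1] and [k + 2] are complementary, while [tm 1] and [tm 2] are both
     true, so the discrepancy is at 0 or 1. *)
  have tm1 : tm (1 + k./2.*2 + 1) = tm k./2.+1.
    by rewrite -[RHS]tm_double; congr tm; lia.
  have tm2 : tm (1 + k./2.*2 + 2) = ~~ tm k./2.+1.
    by rewrite -tm_doubleS; congr tm; lia.
  have [eqc|neqc] := eqVneq (tm k./2.+1) c.
    by exists 0%N; rewrite tm1.
  exists 1%N; rewrite tm2; split=> // [[|//] _|].
    by rewrite tm1; move: neqc; case: (tm _); case: (c).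
  by move: neqc; case: (tm _); case: (c).
have [||n [eqn tmn tmkn]] := IH k./2; [lia..|].
have tm1 : tm (0 + k./2.*2 + 1) = ~~ tm k./2.
  by rewrite -tm_doubleS; congr tm; lia.
have [eqc|neqc] := eqVneq (tm k./2) c; last first.
  by exists 0%N; rewrite tm1; split=> //; move: neqc; case: (tm _); case: (c).
(* Even [k]: the index [n.+1] found for [k./2] doubles to [n.*2.+2]. Odd positions carry complements
   of earlier bits; position 1 needs [eqc]. *)
exists n.*2.+1; split=> [i lti||].
- have := odd_double_half i.+1.
  move: (odd i.+1) (i.+1./2) => [] j /= defi; rewrite -defi.
    have -> : (0 + k./2.*2 + (1 + j.*2) = (k./2 + j).*2.+1)%N by lia.
    rewrite add1n !tm_doubleS; case: j defi => [_|j defi].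
      by rewrite addn0 eqc; case: (c).
    by rewrite eqn ?addbN //; lia.
  rewrite !add0n -doubleD !tm_double.
  by case: j defi => [//|j defi]; apply: eqn; lia.
- by rewrite -doubleS tm_double.
by rewrite -doubleS -doubleD tm_double.
Qed.

(** * The sequence of the theorem *)

(* The bits [x y] stand for [eps_n] and [eps_(n+1)]. *)
Definition code (b t : int) (x y : bool) : int :=
  y%:Z - (2 * t - b - 1) * x%:Z + t - 1.

Definition tm_seq (b t : int) (n : nat) : int := code b t (tm n) (tm n.+1).

Lemma code_neg (b t : int) (x y : bool) :
  code b t (~~ x) (~~ y) = b - code b t x y.
Proof. by rewrite /code; case: x; case: y => /=; lia. Qed.

Lemma tm_seq0 (b t : int) : tm_seq b t 0 = t.
Proof. by rewrite /tm_seq /code /=; lia. Qed.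

Lemma tm_seqE (b t : int) (n : nat) :
  tm_seq b t n =
  thue_morse n.+1 - (2 * t - b - 1) * thue_morse n + t - 1.
Proof. by rewrite !thue_morseE. Qed.

Lemma tm_seq_shift_first_diff (b t : int) (c : bool) (k : nat) :
  b < 2 * t -> (0 < k)%N ->
  exists n,
    [/\ forall i, (i < n)%N ->
          tm_seq b t (k + i) = if c then b - tm_seq b t i else tm_seq b t i
      & if c then b - tm_seq b t n < tm_seq b t (k + n)
        else tm_seq b t (k + n) < tm_seq b t n].
Proof.
move=> hbt k_gt0; have [n [eqn tmn tmkn]] := tm_first_diff c k k_gt0.
(* In the first case the positive coefficient [2 * t - b - 1] of the leading bit decides at position
   0. Otherwise leading bits match up to [c] or have coefficient 0, so the discrepancy of the next
   bits decides. *)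
have [[neqc lt1]|eqc] :
    (tm k = ~~ c /\ b + 1 < 2 * t) \/ (tm k = c \/ 2 * t = b + 1).
- have [|neqc] := eqVneq (tm k) c; first by auto.
  have [d1|d1] := eqVneq (2 * t) (b + 1); first by auto.
  by left; split; [move: neqc; case: (tm _); case: (c)|lia].
- exists 0%N; split=> //; rewrite addn0 tm_seq0 /tm_seq neqc /code.
  by case: (c); case: (tm _) => /=; lia.
exists n; split=> [i lti|].
  have eqS := eqn i lti; rewrite /tm_seq -addnS eqS.
  have [->|d1] : tm (k + i) = c (+) tm i \/ 2 * t = b + 1.
  - case: i lti {eqS} => [|i] lti; last by left; apply: eqn; lia.
    by case: eqc => [eqc|]; [left; rewrite addn0 eqc tm0 addbF|right].
  - by case: (c); rewrite ?addTb ?code_neg ?addFb.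
  by rewrite /code; case: (c); do 3!case: (tm _) => /=; lia.
rewrite /tm_seq -addnS tmkn tmn.
have [->|d1] : tm (k + n) = c (+) tm n \/ 2 * t = b + 1.
- case: n eqn {tmn tmkn} => [|n] eqn; last by left; apply: eqn.
  by case: eqc => [eqc|]; [left; rewrite addn0 eqc tm0 addbF|right].
- by rewrite /code; case: (c); case: (tm _) => /=; lia.
by rewrite /code; case: (c); do 2!case: (tm _) => /=; lia.
Qed.

Lemma tm_seq_strict (b t : int) : b < 2 * t -> Gamma_strict b t (tm_seq b t).
Proof.
move=> hbt; split=> [n||k k_gt0].
- by rewrite /alphabet /tm_seq /code /=; do 2!case: (tm _) => /=; lia.
- by rewrite tm_seq0; apply: alphabet_max.
split.
  have [n [eqn ltn]] := tm_seq_shift_first_diff b t true k hbt k_gt0.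
  by apply: (lex_ltI _ _ n) => [i lti|]; rewrite iter_shiftE // eqn.
have [n [eqn ltn]] := tm_seq_shift_first_diff b t false k hbt k_gt0.
by apply: (lex_ltI _ _ n) => [i lti|]; rewrite iter_shiftE // eqn.
Qed.

(** * Block structure and minimality *)

Lemma tm_seq_block (b t : int) (k j : nat) : (j.+1 < 2 ^ k)%N ->
  tm_seq b t (2 ^ k + j) = b - tm_seq b t j.
Proof.
by move=> ltj; rewrite /tm_seq -addnS !tm_expn2D ?code_neg //; lia.
Qed.

Lemma tm_seq_block_end (b t : int) (k j : nat) : (j.+1 = 2 ^ k)%N ->
  tm_seq b t (2 ^ k + j) = b - tm_seq b t j + 1.
Proof.
move=> defj; rewrite /tm_seq tm_expn2D -?defj // -addnS.
(* [tm] is true at both [2 ^ k] and [2 ^ k.+1]: the second bit is not complemented, whence the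
   increment. *)
have -> : (j.+1 + j.+1 = 2 ^ k.+1)%N by rewrite expnS; lia.
by rewrite defj !tm_expn2 /code; case: (tm j) => /=; lia.
Qed.

(* At a first failure [n >= p], the lower bound for [sigma^p A] gives
   [A (p + n) > b - A n = A (n - p)], against [sigma^(2p) A <= A]. *)
Lemma Gamma_antiperiodic_extend (b t : int) (A : nat -> int) (p : nat) :
  (0 < p)%N -> Gamma b t A ->
  (forall i, (i < p)%N -> A (p + i)%N = b - A i) ->
  forall n, A (p + n)%N = b - A n.
Proof.
move=> p_gt0 [_ _ adm] eqp; elim/ltn_ind=> n IH.
have [|pn] := ltnP n p; first exact: eqp.
have lo : b - A n <= A (p + n)%N.
  rewrite -[A (p + n)%N]iter_shiftE.
  apply: (lex_le_first (bar b A)) => [|i lti].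
    by have [] := adm p.
  by rewrite iter_shiftE IH.
have defn : (n = p + (n - p))%N by lia.
have hi : A (p + n)%N <= A (n - p)%N.
  have -> : (p + n = (p + p) + (n - p))%N by lia.
  rewrite -iter_shiftE; apply: lex_le_first => [|i lti].
    by have [] := adm (p + p)%N.
  by rewrite iter_shiftE -addnA IH ?IH; lia.
have := IH (n - p)%N; rewrite -defn; lia.
Qed.

Lemma tm_seq_le_strict (b t : int) (A : nat -> int) : b < 2 * t ->
  Gamma_strict b t A -> lex_le (tm_seq b t) A.
Proof.
move=> hbt strA; have [//|[n [eqn ltn]]] := lex_le_total (tm_seq b t) A.
have [GA _] := (Gamma_nonperiodicE b t A hbt).2 strA.
have [_ maxA adm] := strA.
have n_gt0 : (0 < n)%N.
  by case: n ltn {eqn} => //; rewrite tm_seq0 (Gamma_head _ _ _ hbt maxA) ltxx.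
have /andP[le_n lt_n] := trunc_log_bounds (isT : 1 < 2)%N n_gt0.
move: (trunc_log 2 n) le_n lt_n => k le_n lt_n.
have defn : (n = 2 ^ k + (n - 2 ^ k))%N by lia.
move: (n - 2 ^ k)%N defn => j defn.
have p_gt0 : (0 < 2 ^ k)%N by rewrite expn_gt0.
have ltj : (j < 2 ^ k)%N by rewrite expnS in lt_n; lia.
have eqA i : (i < j)%N -> A (2 ^ k + i)%N = b - A i.
  by move=> lti; rewrite -!eqn ?tm_seq_block //; lia.
have [lo neq] := (adm _ p_gt0).1.
have leA : b - A j <= A (2 ^ k + j)%N.
  rewrite -iter_shiftE; apply: (lex_le_first (bar b A)) => // i lti.
  by rewrite iter_shiftE eqA.
rewrite defn in ltn; have eqj : tm_seq b t j = A j by apply: eqn; lia.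
have [ltjS|] := ltnP j.+1 (2 ^ k).
  by rewrite tm_seq_block // eqj in ltn; lia.
move=> gej; have defj : (j.+1 = 2 ^ k)%N by lia.
rewrite tm_seq_block_end // eqj in ltn.
(* [leA] and [ltn] now squeeze [A (2 ^ k + j)] to [b - A j], so the whole block is the bar of the
   preceding one. *)
case: neq => i; rewrite iter_shiftE /bar.
rewrite (Gamma_antiperiodic_extend b t A (2 ^ k) p_gt0 GA) // => m ltm.
have [/eqA //|lejm] := ltnP m j.
have -> : m = j by lia.
lia.
Qed.

Lemma tm_seq_smallest (b t : int) : b < 2 * t ->
  is_smallest (Gamma_strict b t) (tm_seq b t).
Proof.
by move=> hbt; split=> [|A]; [apply: tm_seq_strict|apply: tm_seq_le_strict].
Qed.

(** * Fixed points of uniform morphisms of length two *)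

Lemma morph_mkseq (T : Type) (f : T -> seq T) (A : nat -> T) (m : nat) :
  (forall n, f (A n) = [:: A n.*2; A n.*2.+1]) ->
  morph f (mkseq A m) = mkseq A m.*2.
Proof.
move=> fA; elim: m => // m IH.
by rewrite !mkseqS -!cats1 morph_cat IH /morph /= cats0 fA -catA.
Qed.

Lemma onth_mkseq (T : Type) (A : nat -> T) (m n : nat) :
  (n < m)%N -> onth (mkseq A m) n = Some (A n).
Proof.
by move=> ltn; rewrite onthE (nth_map (A 0)) ?size_mkseq // nth_mkseq.
Qed.

(** Uniqueness: a prefix of length [n.+1] has an image of length [n.+1.*2], which already determines
    the letter at [n.+1]. *)
Lemma the_fixed_word_from_doubling (T : Type) (f : T -> seq T) (A : nat -> T) :
  (forall n, f (A n) = [:: A n.*2; A n.*2.+1]) ->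
  the_fixed_word_from f (A 0) A.
Proof.
move=> fA; split=> // [n|B eq0 fixB n].
  by exists n.+1 => k lek; rewrite morph_mkseq // onth_mkseq //; lia.
elim/ltn_ind: n => -[|n] IH //.
have [K /(_ (maxn K n.+1) (leq_maxl _ _))] := fixB n.+1.
have -> : mkseq B (maxn K n.+1) =
    mkseq A n.+1 ++ map B (iota n.+1 (maxn K n.+1 - n.+1)).
  rewrite /mkseq -{1}(subnKC (leq_maxr K n.+1)) iotaD map_cat add0n.
  congr (_ ++ _); apply/eq_in_map => i; rewrite mem_iota => /andP[_ lti].
  exact: IH.
have lt2 : (n.+1 < n.+1.*2)%N by lia.
rewrite morph_cat morph_mkseq // onth_cat size_mkseq lt2 onth_mkseq //.
by case.
Qed.

Lemma the_fixed_word_from_eq (T : Type) (f : T -> seq T) (a : T)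
    (A B : nat -> T) :
  A =1 B -> the_fixed_word_from f a A -> the_fixed_word_from f a B.
Proof.
move=> eqAB [A0 fixA uniqA]; split=> [|n|C C0 fixC n]; first by rewrite -eqAB.
  have [K fixK] := fixA n; exists K => k /fixK.
  by rewrite -eqAB (eq_mkseq eqAB).
by rewrite -eqAB uniqA.
Qed.

Definition bit_letter (x y : bool) : letter :=
  if x then (if y then e1 else e0) else (if y then e3 else e2).

Definition tm_letter (n : nat) : letter := bit_letter (tm n) (tm n.+1).

(** On pairs of consecutive bits, [Theta] sends [(x, y)] to [(x, ~~ x)] and [(~~ x, y)], as the
    Thue-Morse recurrence does. *)
Lemma Theta_tm_letter (n : nat) :
  Theta (tm_letter n) = [:: tm_letter n.*2; tm_letter n.*2.+1].
Proof.
rewrite /tm_letter -doubleS !tm_doubleS !tm_double.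
by case: (tm n); case: (tm n.+1).
Qed.

Lemma Theta_infE (n : nat) : Theta_inf n = tm_letter n.
Proof.
have iterE k : iter k (morph Theta) [:: e3] = mkseq tm_letter (2 ^ k).
  elim: k => // k IH; rewrite iterS IH (morph_mkseq _ _ _ _ Theta_tm_letter).
  by rewrite expnS mul2n.
by rewrite /Theta_inf iterE nth_mkseq // ltn_expl.
Qed.

Lemma tm_seq_rename4 (b t : int) (n : nat) :
  tm_seq b t n = rename4 b t (tm_letter n).
Proof.
by rewrite /tm_seq /tm_letter /code; do 2!case: (tm _) => /=; lia.
Qed.

Lemma rename4_inj (b t : int) : b + 3 <= 2 * t -> injective (rename4 b t).
Proof. by move=> hbt [] [] //=; lia. Qed.

Lemma Theta_bt_rename4 (b t : int) (e : letter) : b + 3 <= 2 * t ->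
  Theta_bt b t (rename4 b t e) = map (rename4 b t) (Theta e).
Proof.
by move=> hbt; rewrite /Theta_bt; case: e => /=; repeat case: eqP => ? //; lia.
Qed.

Theorem theorem2p11 (b t : int) (hb : 0 < b) (ht : 0 <= t <= b)
    (hbt : b < 2 * t) :
  let Gamma_nonper := fun A : nat -> int => Gamma b t A /\ ~ periodic A in
  [/\ exists M : nat -> int, is_smallest Gamma_nonper M,
      forall M : nat -> int,
        is_smallest Gamma_nonper M <-> is_smallest (Gamma_strict b t) M
    & forall M : nat -> int, is_smallest Gamma_nonper M ->
      [/\ forall n : nat,
            M n = thue_morse n.+1 - (2 * t - b - 1) * thue_morse n + t - 1,
          b + 3 <= 2 * t ->
            [/\ injective (rename4 b t),
                forall e : letter,
                  Theta_bt b t (rename4 b t e) = map (rename4 b t) (Theta e)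
              & the_fixed_word_from (Theta_bt b t) t M],
          2 * t = b + 2 -> forall n : nat, M n = g_map b t (Theta_inf n)
        & 2 * t = b + 1 -> forall n : nat, M n = h_map t (Theta_inf n)]].
Proof.
move=> Gamma_nonper.
have strictE A : Gamma_nonper A <-> Gamma_strict b t A.
  exact: Gamma_nonperiodicE.
have minN : is_smallest Gamma_nonper (tm_seq b t).
  by apply/(is_smallest_iff _ _ _ strictE); apply: tm_seq_smallest.
split=> [|M|M minM]; [by exists (tm_seq b t)|exact: is_smallest_iff|].
have MN : tm_seq b t =1 M by apply: is_smallest_uniq minN minM.
split=> [n|hbt3|hbt2 n|hbt1 n].
- by rewrite -MN tm_seqE.
- split=> [|e|]; [exact: rename4_inj|exact: Theta_bt_rename4|].
  apply: the_fixed_word_from_eq MN _.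
  rewrite -[X in the_fixed_word_from _ X](tm_seq0 b).
  apply: the_fixed_word_from_doubling => n.
  by rewrite !tm_seq_rename4 Theta_bt_rename4 // Theta_tm_letter.
(* Here [b - t + 1 = t - 1], so [rename4] merges [e1] and [e2]. *)
- rewrite -MN tm_seq_rename4 Theta_infE.
  by case: (tm_letter n) => /=; lia.
(* Here [b - t = t - 1], so [rename4] merges [e0] with [e2] and [e1] with [e3]. *)
rewrite -MN tm_seq_rename4 Theta_infE.
by case: (tm_letter n) => /=; lia.
Qed.
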